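(* Let the channel gains form an $m$-dependent frequency-selective channel with $K=N$, and assume each $|h_{n,n,k}|$ has a continuous distribution. Let $\varepsilon>0$ and let the M-FSIG parameter be an integer $M=M_N$ with $M\ge(e+\varepsilon)(m+1)\ln N$ and $M/N\to0$. For a profile $\mathbf a$ let $N_c(\mathbf a)$ be its number of sharing users. Then $\max_{\mathbf a^*\in\mathcal P_e}N_c(\mathbf a^* )/N\to0$ in probability as $N\to\infty$ (with the convention that the maximum over an empty set is $0$); in particular, for any PNE $\mathbf a^*$, $N_c(\mathbf a^* )/N\to0$ in probability.
   Context: $N$ users, $K=N$ REs, complex channel gains $h_{n_1,n_2,k}$. Given an integer $m\ge0$ not depending on $N$, they form an $m$-dependent frequency-selective channel if: (i) for each pair $(n_1,n_2)$, $h_{n_1,n_2,1},\dots,h_{n_1,n_2,K}$ are identically distributed and $\Pr(|h_{n_1,n_2,k}|=0)=0$; (ii) the vectors $(h_{n_1,n_2,k})_{k=1}^K$ for distinct pairs are mutually independent; (iii) for each pair, $(h_{n_1,n_2,k})_k$ is $m$-dependent: for every $s$, $(h_{n_1,n_2,k})_{k\le s}$ is independent of $(h_{n_1,n_2,k})_{k>s+m}$. Powers $P_n>0$, noise $N_0>0$, profiles $\mathbf a\in\{1,\dots,K\}^N$, interference $I_k(\mathbf a_{-n})=\sum_{m'\ne n:\,a_{m'}=k}|h_{m',n,k}|^2P_{m'}$. $|h_{n,n,(j)}|$ is the $j$-th smallest of $|h_{n,n,1}|,\dots,|h_{n,n,K}|$. M-FSIG with integer parameter $M$: utility $u_n(\mathbf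 a)=\log_2\!\big(1+\frac{P_n|h_{n,n,(K-M+1)}|^2}{N_0+I_{a_n}(\mathbf a_{-n})}\big)$ if $|h_{n,n,a_n}|\ge|h_{n,n,(K-M+1)}|$, and $0$ otherwise. $\mathcal P_e$ is its set of pure Nash equilibria (profiles where no user can strictly improve his utility unilaterally). A shared RE is one chosen by more than one user; a sharing user is a user whose chosen RE is shared. *)

(* Defs.v *)
From HB Require Import structures.
From mathcomp Require Import all_boot all_order all_algebra.
From mathcomp Require Import all_classical all_reals all_analysis.
Set Implicit Arguments. Unset Strict Implicit. Unset Printing Implicit Defensive.
Import Order.TTheory GRing.Theory Num.Theory.
Import numFieldNormedType.Exports.
Local Open Scope classical_set_scope.
Local Open Scope ring_scope.

Section FSIG.
Variable R : realType.

(* A complex channel gain is represented by its (real part, imaginary part),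
   an element of the measurable space R * R (product Borel sigma-algebra). *)
Definition cmod2 (z : R * R) : R := z.1 ^+ 2 + z.2 ^+ 2.
Definition cmod (z : R * R) : R := Num.sqrt (cmod2 z).

Variables (d : measure_display) (T : measurableType d) (P : probability T R).

(* Mutual independence of the groups of random elements (X i j)_j, i : I.
   Stated on the pi-system of cylinder events (which generates the sigma-algebra
   of each group). *)
Definition indep_groups (I J : finType) (X : I -> J -> T -> (R * R)%type) : Prop :=
  forall B : I -> J -> set (R * R)%type, (forall i j, measurable (B i j)) ->
    fine (P (\bigcap_i \bigcap_j (X i j @^-1` B i j))) =
    \prod_(i : I) fine (P (\bigcap_j (X i j @^-1` B i j))).

Definition m_dependent (K m : nat) (X : 'I_K -> T -> (R * R)%type) : Prop :=
  forall s : nat, forall B : 'I_K -> set (R * R)%type, (forall k, measurable (B k)) ->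
    fine (P ((\bigcap_(k in [set k : 'I_K | (k <= s)%N]) (X k @^-1` B k)) `&`
             (\bigcap_(k in [set k : 'I_K | (s + m < k)%N]) (X k @^-1` B k)))) =
    fine (P (\bigcap_(k in [set k : 'I_K | (k <= s)%N]) (X k @^-1` B k))) *
    fine (P (\bigcap_(k in [set k : 'I_K | (s + m < k)%N]) (X k @^-1` B k))).

(* m-dependent frequency-selective channel with N users and K = N REs;
   h n1 n2 k is the gain from user n1 to user n2 on RE k. *)
Definition mdep_fs_channel (N m : nat) (h : 'I_N -> 'I_N -> 'I_N -> T -> (R * R)%type) : Prop :=
  (forall n1 n2 k, measurable_fun setT (h n1 n2 k)) /\
  (forall n1 n2 k k' (B : set (R * R)%type), measurable B ->
      P (h n1 n2 k @^-1` B) = P (h n1 n2 k' @^-1` B)) /\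
  (forall n1 n2 k, P [set t | cmod (h n1 n2 k t) = 0] = 0%E) /\
  indep_groups (fun p : 'I_N * 'I_N => fun k : 'I_N => h p.1 p.2 k) /\
  (forall n1 n2, m_dependent m (h n1 n2)).

End FSIG.

Section Game.
Variable R : realType.
Variable N : nat.

Definition profile := {ffun 'I_N -> 'I_N}.

(* realisation of the gains *)
Variable g : 'I_N -> 'I_N -> 'I_N -> (R * R)%type.
Variables (Pw : 'I_N -> R) (N0 : R) (M : nat).

Definition ord_stat (n : 'I_N) (j : nat) : R :=
  nth 0 (sort <=%R [seq cmod (g n n k) | k <- enum 'I_N]) j.-1.

Definition thr (n : 'I_N) : R := ord_stat n (N - M + 1).

Definition interf (a : profile) (n k : 'I_N) : R :=
  \sum_(m' : 'I_N | (m' != n) && (a m' == k)) cmod2 (g m' n k) * Pw m'.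

Definition log2 (x : R) : R := ln x / ln 2.

Definition util (a : profile) (n : 'I_N) : R :=
  if thr n <= cmod (g n n (a n))
  then log2 (1 + Pw n * thr n ^+ 2 / (N0 + interf a n (a n)))
  else 0.

Definition upd (a : profile) (n b : 'I_N) : profile :=
  [ffun j => if j == n then b else a j].

Definition isPNE (a : profile) : bool :=
  [forall n : 'I_N, forall b : 'I_N, util (upd a n b) n <= util a n].

Definition Nc (a : profile) : nat :=
  #|[set n : 'I_N | [exists m' : 'I_N, (m' != n) && (a m' == a n)]]|.

Definition maxNc_PNE : nat := \max_(a : profile | isPNE a) Nc a.

End Game.

(* Main.v *)
(* At a PNE a sharing user has positive interference, so every RE that is strong
   for him (gain at least his threshold) is occupied: otherwise he would move
   there. Since K = N, having N_c sharing users leaves at least N_c / 2 REs empty.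
   So N_c > delta N yields a set U of users with |U| > delta N and a set E of REs
   with |E| >= delta N / 2 such that, for every n in U, all gains of n on E lie
   below the M-th largest gain of n. Let x_n be the level exceeded with
   probability M / (2 N). Then either no gain of n on E reaches x_n, or at least M
   gains of n reach x_n, twice the expected number. By m-dependence the variance
   of such counts is at most (2 m + 1) times their mean, and Chebyshev bounds the
   probability of this event by O(1 / M). Users are independent, so a union bound
   over the 4^N pairs (U, E) gives 4^N O(1 / M)^(delta N), which tends to 0 because
   M tends to infinity. *)
Require Import Defs.
From HB Require Import structures.
From mathcomp Require Import all_boot all_order all_algebra.
From mathcomp Require Import all_classical all_reals all_analysis.
From mathcomp Require Import measurable_realfun zify ring lra.
Set Implicit Arguments. Unset Strict Implicit. Unset Printing Implicit Defensive.
Import Order.TTheory GRing.Theory Num.Theory.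
Import numFieldNormedType.Exports.
Local Open Scope classical_set_scope.
Local Open Scope ring_scope.

(** * Real-valued probabilities and random variables with finitely many values *)

Section FiniteProbability.
Variables (R : realType) (d : measure_display) (T : measurableType d).
Variable P : probability T R.

Definition pr (A : set T) : R := fine (P A).

Lemma prE (A : set T) : measurable A -> P A = (pr A)%:E.
Proof. by move=> mA; rewrite fineK ?fin_num_measure. Qed.

Lemma pr_ge0 (A : set T) : 0 <= pr A.
Proof. by rewrite fine_ge0. Qed.

Lemma pr_setT : pr setT = 1.
Proof. by rewrite /pr probability_setT. Qed.

Lemma le_pr (A B : set T) :
  measurable A -> measurable B -> A `<=` B -> pr A <= pr B.
Proof.
by move=> mA mB AB; rewrite -lee_fin -!prE//; apply: le_measure; rewrite ?inE.
Qed.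

Lemma prU (A B : set T) :
  measurable A -> measurable B -> pr (A `|` B) <= pr A + pr B.
Proof.
move=> mA mB; rewrite -lee_fin EFinD -!prE//; last exact: measurableU.
exact: measureU2.
Qed.

Lemma pr_bigsetU (I : Type) (s : seq I) (Q : pred I) (A : I -> set T) :
  (forall i, Q i -> measurable (A i)) ->
  pr (\big[setU/set0]_(i <- s | Q i) A i) <= \sum_(i <- s | Q i) pr (A i).
Proof.
move=> mA; elim: s => [|i s IH]; first by rewrite !big_nil /pr measure0.
rewrite !big_cons; case: ifPn => // Qi.
apply: (le_trans (prU (mA i Qi) (bigsetU_measurable _ _))) => //.
by rewrite lerD2l.
Qed.

Lemma pr_bigcup0 (I : finType) (A : I -> set T) :
  (forall i, measurable (A i)) -> (forall i, pr (A i) = 0) ->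
  pr (\bigcup_i A i) = 0.
Proof.
move=> mA A0.
have -> : \bigcup_i A i = \big[setU/set0]_(i : I) A i.
  by rewrite -bigcup_seq; apply: eq_bigcupl; split => i //= _; rewrite mem_index_enum.
apply/eqP; rewrite eq_le pr_ge0 andbT.
by apply: (le_trans (pr_bigsetU _ _)) => //; rewrite big1.
Qed.

Section FiniteValued.
Variables (F : finType) (Z : T -> F).
Hypothesis mZ : forall x, measurable [set t | Z t = x].

Lemma preimage_finE (Q : pred F) :
  [set t | Q (Z t)] = \bigcup_(x in [set` enum Q]) [set t | Z t = x].
Proof.
apply/seteqP; split => [t Qt|t [x]] /=; last by rewrite mem_enum => Qx ->.
by exists (Z t) => //=; rewrite mem_enum.
Qed.

Lemma measurable_fin (Q : pred F) : measurable [set t | Q (Z t)].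
Proof. by rewrite preimage_finE; apply: fin_bigcup_measurable. Qed.

Lemma pr_fin (Q : pred F) :
  pr [set t | Q (Z t)] = \sum_(x | Q x) pr [set t | Z t = x].
Proof.
apply: EFin_inj; rewrite -prE ?preimage_finE; last first.
  by rewrite -preimage_finE; exact: measurable_fin.
rewrite measure_fin_bigcup//; last first.
  by move=> x y _ _ [t [/= <- <-]].
rewrite -fsbig_seq ?enum_uniq// big_enum/= -sumEFin.
by apply: eq_bigr => x _; rewrite prE.
Qed.

End FiniteValued.

Section Pattern.
Variables (I : finType) (A : I -> set T).
Hypothesis mA : forall i, measurable (A i).

(** The events are gathered into one random variable with finitely many values, so that expectations
    become finite sums over subsets and need no integral. *)
Definition pattern (t : T) : {set I} := [set i | `[< A i t >]]%SET.

Lemma in_pattern i t : (i \in pattern t) = `[< A i t >].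
Proof. by rewrite inE. Qed.

Lemma patternE (X : {set I}) :
  [set t | pattern t = X] = \bigcap_i (if i \in X then A i else ~` A i).
Proof.
apply/seteqP; split => [t /= <- i _|t /= H].
  by rewrite in_pattern; case: ifPn => /asboolP.
apply/setP => i; rewrite in_pattern; have := H i Logic.I.
by case: ifPn => _ /asboolP // /asboolP/asboolPn/negbTE.
Qed.

Lemma measurable_pattern X : measurable [set t | pattern t = X].
Proof.
rewrite patternE; apply: fin_bigcap_measurable => // i _.
by case: ifP => _ //; exact: measurableC.
Qed.

End Pattern.

End FiniteProbability.

(** * Second moments of counts of [m]-dependent events *)

Lemma card_near (K m : nat) (k : 'I_K) :
  (#|[set l : 'I_K | (k <= l + m) && (l <= k + m)]%SET| <= m.*2.+1)%N.
Proof.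
rewrite cardE -(size_map val) -[leqRHS](size_iota (k - m)).
apply: uniq_leq_size; first by rewrite (map_inj_uniq val_inj) enum_uniq.
move=> x /mapP[l]; rewrite mem_enum inE => /andP[kl lk] ->.
by rewrite mem_iota -addnn /=; apply/andP; split; lia.
Qed.

Section MDependentCount.
Variables (R : realType) (d : measure_display) (T : measurableType d).
Variable P : probability T R.
Variables (K m : nat) (A : 'I_K -> set T) (q : R).
Hypothesis mA : forall k, measurable (A k).
Hypothesis prA : forall k, pr P (A k) = q.
Hypothesis indepA :
  forall k l : 'I_K, (k + m < l)%N -> pr P (A k `&` A l) = q * q.

(** Law of the pattern: the expectation of [f (pattern A t)] is [\sum_X w X * f X]. *)
Let w (X : {set 'I_K}) : R := pr P [set t | pattern A t = X].

Let w_pr (Q : pred {set 'I_K}) :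
  \sum_X w X * (Q X)%:R = pr P [set t | Q (pattern A t)].
Proof.
rewrite (pr_fin _ (measurable_pattern mA)) [RHS]big_mkcond/=.
by apply: eq_bigr => X _; case: (Q X); rewrite ?mulr1 ?mulr0.
Qed.

Let w1 : \sum_X w X = 1.
Proof.
rewrite -[RHS](pr_setT P); under eq_bigr do rewrite -[w _]mulr1.
by rewrite (w_pr predT); congr (pr P _); apply/seteqP; split.
Qed.

Let w_in k : \sum_X w X * (k \in X)%:R = q.
Proof.
rewrite (w_pr (fun X => k \in X)) -(prA k); congr (pr P _).
by apply/seteqP; split => t /=; rewrite in_pattern => ?; apply/asboolP.
Qed.

Let cov k l : \sum_X w X * (((k \in X)%:R - q) * ((l \in X)%:R - q)) =
  pr P (A k `&` A l) - q * q.
Proof.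
have -> : pr P (A k `&` A l) = \sum_X w X * ((k \in X) && (l \in X))%:R.
  rewrite (w_pr (fun X => (k \in X) && (l \in X))); congr (pr P _).
  apply/seteqP; split => t /=; rewrite !in_pattern.
    by move=> [a b]; apply/andP; split; apply/asboolP.
  by move=> /andP[/asboolP a /asboolP b].
transitivity (\sum_X w X * ((k \in X) && (l \in X))%:R
    - (\sum_X w X * (k \in X)%:R) * q - (\sum_X w X * (l \in X)%:R) * q
    + (\sum_X w X) * (q * q)).
  rewrite !mulr_suml -!sumrB -big_split/=; apply: eq_bigr => X _.
  by rewrite -mulnb natrM; ring.
by rewrite !w_in w1; ring.
Qed.

Let q_ge0 (k : 'I_K) : 0 <= q.
Proof. by rewrite -(prA k) pr_ge0. Qed.

(** Indices more than [m] apart have zero covariance by independence; for close ones the joint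
    probability is at most [q]. *)
Let cov_le k l : pr P (A k `&` A l) - q * q <=
  (if (k <= l + m)%N && (l <= k + m)%N then q else 0).
Proof.
have [lk|kl] := ltnP (l + m) k; first by rewrite setIC indepA//= subrr.
have [kl'|lk] := ltnP (k + m) l; first by rewrite indepA//= subrr.
rewrite /= lerBlDr (le_trans (_ : _ <= q))//.
  by rewrite -(prA k); apply: le_pr; [exact: measurableI|by []|exact: subIsetl].
by rewrite lerDl mulr_ge0// (q_ge0 k).
Qed.

(** The squared deviation expands into a double sum of covariances, and by [card_near] each index
    has at most [2m + 1] partners that contribute [q]. *)
Let variance_le (F : {set 'I_K}) :
  \sum_X w X * (#|X :&: F|%:R - #|F|%:R * q) ^+ 2 <=
  (m.*2.+1)%:R * (#|F|%:R * q).
Proof.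
have cE (X : {set 'I_K}) : #|X :&: F|%:R - #|F|%:R * q
    = \sum_(k in F) ((k \in X)%:R - q).
  rewrite sumrB sumr_const mulr_natl -sum1_card natr_sum; congr (_ - _).
  rewrite [LHS]big_mkcond [RHS]big_mkcond/=; apply: eq_bigr => k _.
  by rewrite inE andbC; case: (k \in F) => //=; case: (k \in X).
under eq_bigr => X _.
  rewrite cE expr2 big_distrlr/= mulr_sumr.
  under eq_bigr do rewrite mulr_sumr.
  over.
rewrite exchange_big/= mulrCA mulr_natl -sumr_const.
apply: ler_sum => k kF.
rewrite exchange_big/=; under eq_bigr do rewrite cov.
apply: (le_trans (ler_sum _ (fun l _ => cov_le k l))).
apply: (@le_trans _ _ (\sum_(l : 'I_K)
    (if (k <= l + m)%N && (l <= k + m)%N then q else 0))).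
  rewrite big_mkcond/=; apply: ler_sum => l _.
  by case: ifPn => // _; case: ifPn => // _; exact: q_ge0 k.
rewrite -big_mkcond sumr_const -[leLHS]mulr_natl ler_wpM2r ?(q_ge0 k)//.
by rewrite ler_nat; have := card_near m k; rewrite cardsE.
Qed.

(* Chebyshev; the two uses are "no success in [F]" and "at least twice as many
   successes as expected". *)
Lemma mdep_count_deviation (F : {set 'I_K}) (Q : pred {set 'I_K}) :
  0 < #|F|%:R * q ->
  (forall X, Q X -> (#|F|%:R * q) ^+ 2 <= (#|X :&: F|%:R - #|F|%:R * q) ^+ 2) ->
  pr P [set t | Q (pattern A t)] <= (m.*2.+1)%:R / (#|F|%:R * q).
Proof.
set mu := #|F|%:R * q => mu0 HQ.
rewrite ler_pdivlMr// -(ler_pM2r mu0) -mulrA -expr2.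
apply: le_trans (variance_le F).
rewrite -(w_pr Q) mulr_suml; apply: ler_sum => X _.
rewrite -mulrA ler_wpM2l ?pr_ge0//; have [QX|_] := boolP (Q X).
  by rewrite mul1r HQ.
by rewrite mul0r sqr_ge0.
Qed.

End MDependentCount.

(** * Quantiles of atomless distributions *)

Section Quantile.
Variables (R : realType) (d : measure_display) (T : measurableType d).
Variable P : probability T R.
Variable X : T -> R.
Hypothesis mX : measurable_fun setT X.

Let mge x : measurable [set t | x <= X t].
Proof.
rewrite (_ : [set t | _] = setT `&` X @^-1` `[x, +oo[); first exact: mX.
by rewrite setTI; apply/seteqP; split => t /=; rewrite in_itv/= andbT.
Qed.

Let pr_cvg (F : nat -> set T) (G : set T) : (forall n, measurable (F n)) ->
  measurable G -> P \o F @ \oo --> P G -> (fun n => pr P (F n)) @ \oo --> pr P G.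
Proof.
move=> mF mG; rewrite (prE P mG) => H.
exact: (fine_cvg H).
Qed.

(** The level is the supremum [s] of the [x] with [P(X >= x) >= q]. Continuity of the measure along
    [s - 1/n] gives [P(X >= s) >= q], along [s + 1/n] it gives [P(X > s) <= q], and the absence of
    an atom at [s] identifies the two. *)
Lemma upper_quantile (q : R) : (forall t, 0 <= X t) ->
  (forall x, P [set t | X t = x] = 0%E) -> 0 < q -> q <= 1 ->
  exists x, pr P [set t | x <= X t] = q.
Proof.
move=> X0 Xat q0 q1.
pose S := [set x | q <= pr P [set t | x <= X t]].
have S0 : S 0.
  rewrite /S/= (_ : [set t | 0 <= X t] = setT) ?pr_setT//.
  by apply/seteqP; split => // t _ /=; exact: X0.
have Sdown x y : y <= x -> S x -> S y.
  move=> yx Sx; apply: (le_trans Sx); apply: le_pr => // t /=.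
  exact: le_trans yx.
(* The tails tend to 0 and [q] is positive, so large levels fall outside [S]. *)
have [b Sb] : exists b, forall x, S x -> x <= b.
  have c0 : (fun n : nat => pr P [set t | n%:R <= X t]) @ \oo --> pr P set0.
    apply: pr_cvg => //.
    have <- : \bigcap_n [set t | n%:R <= X t] = set0.
      apply/seteqP; split => // t /= H.
      have := H (Num.truncn (X t)).+1 Logic.I => /=.
      by rewrite leNgt truncnS_gt.
    apply: nonincreasing_cvg_mu => //.
    - by rewrite ltey_eq fin_num_measure.
    - exact: bigcap_measurable.
    - move=> k l kl; apply/subsetPset => t /=; apply: le_trans.
      by rewrite ler_nat.
  have /cvgrPdist_lt/(_ q q0)[n _ Hn] := c0.
  exists n%:R => x Sx; rewrite leNgt; apply/negP => nx.
  have := Hn n (leqnn _); rewrite /= {1}/pr measure0/= sub0r normrN ger0_norm ?pr_ge0//.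
  rewrite ltNge => /negP; apply; exact: Sdown (ltW nx) Sx.
have hS : has_sup S by split; [exists 0|exists b].
pose s := sup S.
have ub x : S x -> x <= s by move=> Sx; apply: ub_le_sup => //; case: hS.
have inv_cvg0 : (fun n : nat => n.+1%:R^-1 : R) @ \oo --> (0 : R).
  exact: cvg_harmonic.
have msgt : measurable [set t | s < X t].
  rewrite (_ : [set t | _] = setT `&` X @^-1` `]s, +oo[); first exact: mX.
  by rewrite setTI; apply/seteqP; split => t /=; rewrite in_itv/= andbT.
have ms : measurable [set t | X t = s].
  rewrite (_ : [set t | _] = setT `&` X @^-1` [set s]); last by rewrite setTI.
  exact: mX.
exists s; apply/eqP; rewrite eq_le; apply/andP; split.
  have gtq : pr P [set t | s < X t] <= q.
    have c : (fun n : nat => pr P [set t | s + n.+1%:R^-1 <= X t]) @ \oo -->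
        pr P [set t | s < X t].
      apply: pr_cvg => //.
      have <- : \bigcup_n [set t | s + n.+1%:R^-1 <= X t] = [set t | s < X t].
        apply/seteqP; split => t /=.
          by move=> [n _ /=]; apply: lt_le_trans; rewrite ltrDl.
        rewrite -subr_gt0 => sX.
        have /cvgrPdist_lt/(_ _ sX)[n _ Hn] := inv_cvg0.
        exists n => //=; have := Hn n (leqnn _).
        by rewrite /= sub0r normrN ger0_norm// -lerBrDl => /ltW.
      apply: nondecreasing_cvg_mu => //.
      - exact: bigcup_measurable.
      - move=> k l kl; apply/subsetPset => t /=; apply: le_trans.
        by rewrite lerD2l lef_pV2 ?posrE// ler_nat.
    apply: (cvgr_to_le c); near=> n.
    rewrite leNgt; apply/negP => /ltW /ub.
    by rewrite leNgt ltrDl invr_gt0 ltr0n.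
  apply: le_trans gtq.
  rewrite -[leRHS]addr0 -[X in _ <= _ + X](_ : pr P [set t | X t = s] = 0); last first.
    by rewrite /pr Xat.
  apply: le_trans (prU _ _ _) => //.
  apply: le_pr => //; first exact: measurableU.
  by move=> t /=; rewrite le_eqVlt => /orP[/eqP ->|]; [right|left].
have c : (fun n : nat => pr P [set t | s - n.+1%:R^-1 <= X t]) @ \oo -->
    pr P [set t | s <= X t].
  apply: pr_cvg => //.
  have <- : \bigcap_n [set t | s - n.+1%:R^-1 <= X t] = [set t | s <= X t].
    apply/seteqP; split => t /=; last first.
      by move=> sX n _ /=; apply: le_trans sX; rewrite gerBl.
    move=> H; rewrite leNgt; apply/negP; rewrite -subr_gt0 => Xs.
    have /cvgrPdist_lt/(_ _ Xs)[n _ Hn] := inv_cvg0.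
    have := Hn n (leqnn _); rewrite /= sub0r normrN ger0_norm// ltNge => /negP; apply.
    by rewrite lerBlDr -lerBlDl; exact: H.
  apply: nonincreasing_cvg_mu => //.
  - by rewrite ltey_eq fin_num_measure.
  - exact: bigcap_measurable.
  - move=> k l kl; apply/subsetPset => t /=; apply: le_trans.
    by rewrite lerD2l lerN2 lef_pV2 ?posrE// ler_nat.
apply: (cvgr_to_ge c); near=> n.
have [] := @sup_adherent _ S n.+1%:R^-1 _ hS; first by rewrite invr_gt0.
by move=> e Se /ltW ?; exact: Sdown Se.
Unshelve. all: by end_near.
Qed.

End Quantile.

(** * Occupancy counts: sharing users against empty REs *)

Section Occupancy.
Variables (N : nat) (a : {ffun 'I_N -> 'I_N}).

Definition users_on (k : 'I_N) : {set 'I_N} := [set j | a j == k]%SET.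
Definition empty_REs : {set 'I_N} := [set k | users_on k == finset.set0]%SET.
Definition sharing_users : {set 'I_N} :=
  [set n | [exists m', (m' != n) && (a m' == a n)]]%SET.

Lemma sharing_usersE n : (n \in sharing_users) = (1 < #|users_on (a n)|)%N.
Proof.
rewrite inE (cardsD1 n) inE eqxx add1n ltnS card_gt0; apply/existsP/set0Pn.
  by move=> [j /andP[jn aj]]; exists j; rewrite !inE jn aj.
by move=> [j]; rewrite !inE => jn; exists j.
Qed.

Lemma sharing_le_double_empty : (#|sharing_users| <= 2 * #|empty_REs|)%N.
Proof.
have cardE (Q : pred 'I_N) : #|[set n | Q (a n)]%SET| = (\sum_k #|users_on k| * Q k)%N.
  rewrite -sum1_card big_mkcond (partition_big a predT)//=.
  apply: eq_bigr => k _; rewrite -sum1_card mulnC.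
  have [Qk|Qk] := boolP (Q k); rewrite ?mul1n ?mul0n.
    rewrite [RHS](eq_bigl (fun i => a i == k)); last by move=> j; rewrite inE.
    by apply: eq_bigr => j /eqP ajk; rewrite inE ajk Qk.
  by rewrite big1// => j /eqP ajk; rewrite inE ajk (negbTE Qk).
have eN : N = (\sum_k #|users_on k|)%N.
  rewrite -[LHS]card_ord -cardsT.
  rewrite (_ : [set: 'I_N]%SET = [set n | predT (a n)]%SET).
    by rewrite cardE; apply: eq_bigr => k _; rewrite muln1.
  by apply/setP => n; rewrite !inE.
have eS : #|sharing_users| = (\sum_k #|users_on k| * (1 < #|users_on k|))%N.
  rewrite -cardE; congr #|pred_of_set _|.
  by apply/setP => n; rewrite sharing_usersE inE.
have eE : #|empty_REs| = (\sum_k (#|users_on k| == 0))%N.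
  rewrite -sum1_card big_mkcond; apply: eq_bigr => k _.
  by rewrite inE cards_eq0; case: eqP.
(* For an RE with [f] users this reads [f [f > 1] + 2 <= 2 [f = 0] + 2 f]. The terms [2] and [2 f]
   both sum to [2 N], as there are as many REs as users, and cancel. *)
have: (\sum_k (#|users_on k| * (1 < #|users_on k|) + 2) <=
       \sum_k (2 * (#|users_on k| == 0) + 2 * #|users_on k|))%N.
  by apply: leq_sum => k _; case: #|users_on k| => [|[|f]] /=; lia.
have mul2 (F : 'I_N -> nat) : (\sum_k 2 * F k = 2 * \sum_k F k)%N.
  by rewrite big_distrr.
rewrite big_split [leqRHS]big_split/= !mul2 -eN sum_nat_const card_ord -eS -eE.
by rewrite [(N * 2)%N]mulnC leq_add2r.
Qed.

(* The set in [Nc] is a classical set, the one in [sharing_users] a finite set. *)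
Lemma NcE : Nc a = #|sharing_users|.
Proof.
apply: eq_card => n; rewrite [RHS]inE.
by apply/idP/idP => [/set_mem|]; last exact: mem_set.
Qed.

End Occupancy.

(** * The threshold as an order statistic *)

Section Threshold.
Variables (R : realType) (N : nat).
Variables (g : 'I_N -> 'I_N -> 'I_N -> (R * R)%type) (M : nat).
Hypothesis M0 : (0 < M)%N.

Lemma cmod2_ge0 (z : R * R) : 0 <= cmod2 z.
Proof. by rewrite addr_ge0// sqr_ge0. Qed.

Lemma cmod_ge0 (z : R * R) : 0 <= cmod z.
Proof. exact: sqrtr_ge0. Qed.

(** The threshold is the entry of index [N - M], counted from 0, of the sorted gains, hence the
    strict inequality on the right. [M > 0] keeps this index inside the list, away from the default
    value of [nth]. *)
Lemma thr_le (n : 'I_N) (x : R) :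
  (thr g M n <= x) = (N - M < #|[set k | (cmod (g n n k) <= x)%R]%SET|)%N.
Proof.
rewrite /thr /ord_stat addn1/=.
set s := sort _ _.
have cE : #|[set k | (cmod (g n n k) <= x)%R]%SET| = count (fun y => y <= x) s.
  rewrite (permP (permEl (perm_sort _ _))) count_map.
  rewrite -sum1_card -sum1_count big_enum_cond/=.
  by apply: eq_bigl => k; rewrite inE.
have ss : sorted <=%R s by apply: sort_sorted; exact: le_total.
have sz : size s = N by rewrite size_sort size_map size_enum_ord.
have Mi : (N - M < size s)%N by rewrite sz; have := ltn_ord n; lia.
rewrite cE; have [H|H] := ltnP (N - M) (count (fun y => y <= x) s).
  exact: nth_count_le.
by apply/negbTE; rewrite -ltNge; apply: nth_count_gt; rewrite ?H.
Qed.

Lemma thr_ge0 (n : 'I_N) : 0 <= thr g M n.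
Proof.
rewrite leNgt; apply/negP => t0.
have := lexx (thr g M n); rewrite thr_le => /(leq_ltn_trans (leq0n _)).
rewrite card_gt0 => /set0Pn[k]; rewrite inE => kt.
by have := le_lt_trans kt t0; rewrite ltNge cmod_ge0.
Qed.

Lemma thr_gt0 (n : 'I_N) : (forall k, 0 < cmod (g n n k)) -> 0 < thr g M n.
Proof.
move=> g0; rewrite ltNge thr_le -leqNgt; apply: leq_trans (leq0n _).
by rewrite leqn0 cards_eq0; apply/eqP/setP => k; rewrite !inE leNgt g0.
Qed.

End Threshold.

(** What an equilibrium imposes on a sharing user: [X] stands for the REs where the user reaches a
    fixed level, [E] for the empty REs. With a fixed level in place of the random threshold, the
    condition is a union of two deviations of counts. *)
Definition light (N M : nat) (E X : {set 'I_N}) : bool :=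
  [disjoint X & E] || (M <= #|X|)%N.

(** * Unilateral deviations and pure equilibria *)

Section Equilibrium.
Variables (R : realType) (N : nat).
Variables (g : 'I_N -> 'I_N -> 'I_N -> (R * R)%type).
Variables (Pw : 'I_N -> R) (N0 : R) (M : nat).
Hypothesis Pw0 : forall n, 0 < Pw n.
Hypothesis N00 : 0 < N0.
Hypothesis M0 : (0 < M)%N.

Lemma interf_ge0 (a : profile N) n k : 0 <= interf g Pw a n k.
Proof. by apply: sumr_ge0 => j _; rewrite mulr_ge0 ?cmod2_ge0// ltW. Qed.

Lemma ler_log2 (x y : R) : 0 < x -> 0 < y -> (log2 x <= log2 y) = (x <= y).
Proof.
by move=> x0 y0; rewrite ler_pM2r ?ler_ln ?posrE// invr_gt0 ln_gt0// ltr1n.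
Qed.

(** Utilities compared without logarithms or quotients. A choice below the threshold and a zero
    threshold both give utility 0, whence the two guards; otherwise the smaller interference wins.
    The form serves the equilibrium argument and measurability alike. *)
Lemma util_le (a b : profile N) (n : 'I_N) :
  (util g Pw N0 M b n <= util g Pw N0 M a n) =
  ((thr g M n <= cmod (g n n (b n))) ==> (0 < thr g M n) ==>
   (thr g M n <= cmod (g n n (a n))) &&
   (interf g Pw a n (a n) <= interf g Pw b n (b n))).
Proof.
rewrite /util.
have D0 (c : profile N) : 0 < N0 + interf g Pw c n (c n).
  by rewrite ltr_wpDr ?interf_ge0.
set t := thr g M n; have t0 : 0 <= t := thr_ge0 g M0 n.
have Q0 (c : profile N) : 0 <= Pw n * t ^+ 2 / (N0 + interf g Pw c n (c n)).
  by apply: divr_ge0; [apply: mulr_ge0; [exact: ltW|exact: sqr_ge0]|exact: ltW].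
have U0 (c : profile N) : 0 < 1 + Pw n * t ^+ 2 / (N0 + interf g Pw c n (c n)).
  by rewrite ltr_wpDr.
have l0 : 0 = log2 1 :> R by rewrite /log2 ln1 mul0r.
case: (t <= cmod (g n n (b n))) => /=; last first.
  by case: ifP => _; rewrite ?lexx// [leLHS]l0 ler_log2 ?lerDl ?Q0.
have [tpos|/le_lt_trans tneg] := ltP 0 t; last first.
  have t00 : t = 0.
    by apply/eqP; rewrite eq_le t0 andbT leNgt; apply/negP => /tneg; rewrite ltxx.
  by rewrite t00 expr0n/= mulr0 !mul0r !addr0 -l0; case: ifP; rewrite lexx.
have Pt : 0 < Pw n * t ^+ 2 by rewrite mulr_gt0 ?exprn_gt0.
case: ifP => /= _; last first.
  by rewrite [leRHS]l0 ler_log2// gerDl leNgt divr_gt0.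
by rewrite ler_log2// lerD2l ler_pM2l// lef_pV2 ?posrE// lerD2l.
Qed.

Lemma PNE_blocked (a : profile N) (M_le : (M <= N)%N) :
  (forall n n' k, 0 < cmod (g n n' k)) -> isPNE g Pw N0 M a ->
  forall n k, n \in sharing_users a -> k \in empty_REs a ->
    cmod (g n n k) < thr g M n.
Proof.
move=> g0 /forallP aNE n k nS kE; rewrite ltNge; apply/negP => tk.
have := forallP (aNE n) k; rewrite util_le.
have bn : upd a n k n = k by rewrite ffunE eqxx.
rewrite bn tk thr_gt0//= => /andP[_]; apply/negP; rewrite -ltNge.
have -> : interf g Pw (upd a n k) n k = 0.
  rewrite /interf big1// => j; rewrite ffunE => /andP[/negbTE ->] ajk.
  move: kE; rewrite inE => /eqP/setP/(_ j).
  by rewrite !inE ajk.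
(* Another user [j] on the same RE has a nonzero gain there, so the interference before the move is
   strictly positive. *)
move: nS; rewrite inE => /existsP[j jn].
rewrite /interf (bigD1 j)//= ltr_wpDr//.
  by apply: sumr_ge0 => i _; rewrite mulr_ge0 ?cmod2_ge0// ltW.
by rewrite mulr_gt0//; have := g0 j n (a n); rewrite sqrtr_gt0.
Qed.

(** If an empty RE reaches the level [x n], its gain is still below the threshold, so at most
    [N - M] gains are no larger. The others, at least [M] of them, exceed it and hence reach
    [x n]. *)
Lemma PNE_light_user (a : profile N) (M_le : (M <= N)%N) (x : 'I_N -> R) :
  (forall n n' k, 0 < cmod (g n n' k)) -> isPNE g Pw N0 M a ->
  forall n, n \in sharing_users a ->
    light M (empty_REs a) [set k | x n <= cmod (g n n k)]%SET.
Proof.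
rewrite /light => g0 aNE n nS; case: (boolP [disjoint _ & _]) => //=.
rewrite -setI_eq0 => /set0Pn[k]; rewrite !inE => /andP[xk kE].
have := PNE_blocked M_le g0 aNE nS (_ : k \in empty_REs a).
rewrite inE => /(_ kE); rewrite ltNge thr_le// -leqNgt => H.
set L := [set k' | _]%SET in H.
have : (#|~: L| <= #|[set k0 | (x n <= cmod (g n n k0))%R]%SET|)%N.
  apply: subset_leq_card; apply/fintype.subsetP => j; rewrite !inE -ltNge => /ltW.
  exact: le_trans.
by apply: leq_trans; have := cardsC L; rewrite card_ord; lia.
Qed.

End Equilibrium.

(** * Measurability of the events of the game *)

Section Measurability.
Variables (R : realType) (d : measure_display) (T : measurableType d).
Variables (N : nat) (h : 'I_N -> 'I_N -> 'I_N -> T -> (R * R)%type).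
Variables (Pw : 'I_N -> R) (N0 : R) (M : nat).
Hypothesis mh : forall n1 n2 k, measurable_fun setT (h n1 n2 k).
Hypothesis Pw0 : forall n, 0 < Pw n.
Hypothesis N00 : 0 < N0.
Hypothesis M0 : (0 < M)%N.

Lemma measurable_cmod2 : measurable_fun setT (@cmod2 R).
Proof.
apply: measurable_funD; apply: measurable_funX;
  [exact: measurable_fst|exact: measurable_snd].
Qed.

Lemma measurable_cmod : measurable_fun setT (@cmod R).
Proof.
apply: measurableT_comp measurable_cmod2.
by apply: continuous_measurable_fun; exact: sqrt_continuous.
Qed.

Lemma measurable_le_fun (f f' : T -> R) :
  measurable_fun setT f -> measurable_fun setT f' ->
  measurable [set t | f t <= f' t].
Proof.
move=> mf mf'.
rewrite (_ : [set t | _] = setT `&` (fun t => f t <= f' t) @^-1` [set true]).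
  by apply: (measurable_fun_ler mf mf').
by rewrite setTI; apply/seteqP; split.
Qed.

Let g t := fun n1 n2 k => h n1 n2 k t.

Let mcmod n1 n2 k : measurable_fun setT (fun t => cmod (g t n1 n2 k)).
Proof. by apply: measurableT_comp; [exact: measurable_cmod|exact: mh]. Qed.

(** Through [thr_le] the comparison becomes a count in a pattern of measurable events, so sorting is
    never handled as a measurable map. *)
Lemma measurable_thr_le (n : 'I_N) (f : T -> R) : measurable_fun setT f ->
  measurable [set t | thr (g t) M n <= f t].
Proof.
move=> mf.
pose A k := [set t | cmod (g t n n k) <= f t].
have mA k : measurable (A k) by apply: measurable_le_fun.
pose Q (X : {set 'I_N}) := (N - M < #|X|)%N.
rewrite (_ : [set t | _] = [set t | Q (pattern A t)]).
  exact: (measurable_fin (measurable_pattern mA) Q).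
rewrite /Q {Q}.
apply/seteqP; split => t /=; rewrite thr_le//;
  congr (_ < #|pred_of_set _|)%N; apply/setP => k; rewrite !inE.
  by apply/idP/asboolP.
by apply/asboolP/idP.
Qed.

Lemma measurable_interf (a : profile N) n k :
  measurable_fun setT (fun t => interf (g t) Pw a n k).
Proof.
rewrite (_ : (fun t => _) = (fun t => \sum_j
    (if (j != n) && (a j == k) then cmod2 (g t j n k) * Pw j else 0))); last first.
  by apply/funext => t; rewrite /interf big_mkcond.
apply: measurable_sum => j; case: (_ && _) => //.
apply: measurable_funM => //.
by apply: measurableT_comp; [exact: measurable_cmod2|exact: mh].
Qed.

Lemma measurable_PNE (a : profile N) :
  measurable [set t | isPNE (g t) Pw N0 M a].
Proof.
rewrite (_ : [set t | _] = \bigcap_n \bigcap_b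
    [set t | util (g t) Pw N0 M (upd a n b) n <= util (g t) Pw N0 M a n]); last first.
  apply/seteqP; split => t /=.
    by move=> /forallP H n _ b _; exact: (forallP (H n) b).
  by move=> H; apply/forallP => n; apply/forallP => b; exact: H.
apply: fin_bigcap_measurable => // n _; apply: fin_bigcap_measurable => // b _.
rewrite (_ : [set t | _] =
   ~` [set t | thr (g t) M n <= cmod (g t n n (upd a n b n))] `|`
   ([set t | thr (g t) M n <= 0] `|`
   ([set t | thr (g t) M n <= cmod (g t n n (a n))] `&`
    [set t | interf (g t) Pw a n (a n) <=
             interf (g t) Pw (upd a n b) n (upd a n b n)]))).
  apply: measurableU; first by apply: measurableC; exact: measurable_thr_le.
  apply: measurableU; first exact: measurable_thr_le.
  apply: measurableI; first exact: measurable_thr_le.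
  by apply: measurable_le_fun; exact: measurable_interf.
apply/seteqP; split => t /=; rewrite util_le// ltNge.
  move=> /implyP H; case: (boolP (_ <= cmod _)) => [/H|/negP]; last by left.
  move=> /implyP H'; right; case: (boolP (_ <= 0)) => [|/H' /andP]; first by left.
  by right.
move=> H; apply/implyP => Hb; apply/implyP => /negP Ht; apply/andP.
by case: H => // -[].
Qed.

Lemma maxNc_PNE_gt (t : T) (delta : R) : 0 < delta ->
  delta < (maxNc_PNE (g t) Pw N0 M)%:R / N%:R <->
  exists2 a, isPNE (g t) Pw N0 M a & delta < (Nc a)%:R / N%:R.
Proof.
move=> delta0; split; last first.
  move=> [a aNE] /lt_le_trans; apply; rewrite ler_wpM2r// ler_nat.
  exact: leq_bigmax_cond.
(* The maximum is 0 or attained at an equilibrium; [delta > 0] rules out the first case. *)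
have [->|[a aNE ->]] : (maxNc_PNE (g t) Pw N0 M = 0)%N \/
    exists2 a, isPNE (g t) Pw N0 M a & maxNc_PNE (g t) Pw N0 M = Nc a.
- rewrite /maxNc_PNE; elim/big_ind: _ => [|x y Hx Hy|a aNE]; first by left.
    by rewrite /maxn; case: ifP.
  by right; exists a.
- by rewrite mul0r ltNge ltW.
- by exists a.
Qed.

Lemma measurable_maxNc_gt (delta : R) : 0 < delta ->
  measurable [set t | delta < (maxNc_PNE (g t) Pw N0 M)%:R / N%:R].
Proof.
move=> delta0.
rewrite (_ : [set t | _] = \bigcup_(a in [set a : profile N | delta < (Nc a)%:R / N%:R])
    [set t | isPNE (g t) Pw N0 M a]).
  apply: fin_bigcup_measurable => [|a _]; last exact: measurable_PNE.
  exact: finite_finset.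
apply/seteqP; split => t /=; first by move/(maxNc_PNE_gt _ delta0) => [a]; exists a.
by move=> [a aN aNE]; apply/(maxNc_PNE_gt _ delta0); exists a.
Qed.

End Measurability.

(** * Product laws over finitely many users *)

Section Independence.
Variables (R : realType) (d : measure_display) (T : measurableType d).
Variable P : probability T R.

(** The joint variable [Z] has a product law and the event confines it to a product of sets, so the
    sum over this product factors by distributivity. *)
Lemma pr_forall_indep (I F : finType) (W : I -> T -> F) (U : {set I}) (Q : pred F) :
  (forall i x, measurable [set t | W i t = x]) ->
  (forall f : {ffun I -> F}, pr P (\bigcap_i [set t | W i t = f i]) =
     \prod_i pr P [set t | W i t = f i]) ->
  pr P [set t | forall i, i \in U -> Q (W i t)] =
  \prod_(i in U) pr P [set t | Q (W i t)].
Proof.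
move=> mW Wprod.
pose Z t := [ffun i => W i t].
have ZE f : [set t | Z t = f] = \bigcap_i [set t | W i t = f i].
  apply/seteqP; split => t /=; first by move=> <- i _ /=; rewrite ffunE.
  by move=> H; apply/ffunP => i; rewrite ffunE; exact: H.
have mZ f : measurable [set t | Z t = f].
  by rewrite ZE; apply: fin_bigcap_measurable => // i _; exact: mW.
(* Outside [U] the constraint is void and the factor is 1. *)
pose G i : pred F := [pred x | (i \in U) ==> Q x].
have -> : [set t | forall i, i \in U -> Q (W i t)] = [set t | Z t \in family G].
  apply/seteqP; split => t /=.
    by move=> H; apply/familyP => i; rewrite ffunE; apply/implyP; exact: H.
  by move=> /familyP H i iU; have := H i; rewrite ffunE => /implyP; exact.
rewrite (pr_fin _ mZ (fun f => f \in family G)).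
rewrite (eq_bigr (fun f : {ffun I -> F} => \prod_i pr P [set t | W i t = f i]));
  last by move=> f _; rewrite -Wprod -ZE.
rewrite -(bigA_distr_big_dep _ (fun i x => pr P [set t | W i t = x]))/=.
rewrite [RHS]big_mkcond/=; apply: eq_bigr => i _.
rewrite -(pr_fin P (mW i) (G i)) /G /=; case: (i \in U) => //.
by rewrite -[RHS](pr_setT P); congr (pr P _); apply/seteqP; split.
Qed.

End Independence.

(** * Strong REs in the channel: independence and the bound for one user *)

Section Channel.
Variables (R : realType) (d : measure_display) (T : measurableType d).
Variable P : probability T R.
Variables (N m : nat) (h : 'I_N -> 'I_N -> 'I_N -> T -> (R * R)%type).
Hypothesis hch : mdep_fs_channel P m h.

Let mh : forall n1 n2 k, measurable_fun setT (h n1 n2 k).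
Proof. by case: hch. Qed.

Variable x : 'I_N -> R.

Definition strong (n k : 'I_N) : set T := [set t | x n <= cmod (h n n k t)].

Definition strong_gains (n : 'I_N) : set (R * R) := [set z | x n <= cmod z].

Lemma measurable_strong_gains n : measurable (strong_gains n).
Proof.
by apply: measurable_le_fun; [exact: measurable_cst|exact: measurable_cmod].
Qed.

Lemma measurable_strong n k : measurable (strong n k).
Proof.
have := mh n n k measurableT (measurable_strong_gains n).
by rewrite setTI.
Qed.

Lemma pr_strong n k k' : pr P (strong n k) = pr P (strong n k').
Proof.
case: hch => _ [Hid _]; congr fine.
exact: Hid (measurable_strong_gains n).
Qed.

Lemma strong_indep_far n (k l : 'I_N) : (k + m < l)%N ->
  pr P (strong n k `&` strong n l) = pr P (strong n k) * pr P (strong n l).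
Proof.
move=> kl; case: hch => _ [_ [_ [_ /(_ n n)]]].
(* [m]-dependence is applied at [s = k] to cylinders constrained only at [k] and [l]. *)
pose B j := if (j == k) || (j == l) then strong_gains n else setT.
move=> /(_ k B); have -> : \bigcap_(j in [set j : 'I_N | (j <= k)%N]) (h n n j @^-1` B j) = strong n k.
  apply/seteqP; split => t.
    by move=> /(_ k (leqnn _)); rewrite /B eqxx.
  move=> tk j /= jk; rewrite /B; case: eqP => [->//|_].
  by case: eqP => //= jl; move: kl jk; rewrite jl; lia.
have -> : \bigcap_(j in [set j : 'I_N | (k + m < j)%N]) (h n n j @^-1` B j) = strong n l.
  apply/seteqP; split => t.
    by move=> /(_ l kl); rewrite /B eqxx orbT.
  move=> tl j /= kj; rewrite /B orbC; case: eqP => [->//|_].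
  by case: eqP => //= jk; move: kj; rewrite jk; lia.
by apply => j; rewrite /B; case: ifP => // _; exact: measurable_strong_gains.
Qed.

(** The independent groups are indexed by pairs of users. Prescribed patterns are cylinder events on
    the diagonal pairs; the other pairs are left unconstrained and contribute factors 1. *)
Lemma strong_users_indep (f : {ffun 'I_N -> {set 'I_N}}) :
  pr P (\bigcap_n [set t | pattern (strong n) t = f n]) =
  \prod_n pr P [set t | pattern (strong n) t = f n].
Proof.
case: hch => _ [_ [_ [Hind _]]].
pose B (p : 'I_N * 'I_N) (k : 'I_N) : set (R * R) := if p.1 == p.2 then
  (if k \in f p.1 then strong_gains p.1 else ~` strong_gains p.1) else setT.
have diag n : \bigcap_k (h n n k @^-1` B (n, n) k) = [set t | pattern (strong n) t = f n].
  rewrite patternE; apply: eq_bigcapr => k _.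
  by rewrite /B /= eqxx; case: ifP.
have offdiag p : p.1 != p.2 -> \bigcap_k (h p.1 p.2 k @^-1` B p k) = setT.
  move=> /negbTE pp; apply/seteqP; split => // t _ k _.
  by rewrite /B /= pp.
transitivity (pr P (\bigcap_p \bigcap_k (h p.1 p.2 k @^-1` B p k))).
  congr (pr P _); apply/seteqP; split => t H.
    move=> p _; have [pp|/offdiag -> //] := eqVneq p.1 p.2.
    case: p pp => [n n'] /= <-; rewrite diag; exact: H.
  by move=> n _; rewrite -diag; exact: (H (n, n)).
rewrite /pr (Hind B); last first.
  move=> p k; rewrite /B; case: ifP => // _; case: ifP => _.
    exact: measurable_strong_gains.
  by apply: measurableC; exact: measurable_strong_gains.
rewrite -(pair_bigA _ (fun n n' => fine (P (\bigcap_k (h n n' k @^-1` B (n, n') k)))))/=.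
apply: eq_bigr => n _; rewrite (bigD1 n)//= diag big1 ?mulr1// => n' n'n.
by rewrite (offdiag (n, n')) ?probability_setT//= eq_sym.
Qed.

(* [strong n] is calibrated so that each user has [M / 2] strong REs on average. *)
Variable M : nat.
Hypothesis M0 : (0 < M)%N.
Hypothesis x_quantile : forall n k, pr P (strong n k) = M%:R / (2 * N%:R).

(** The mean number of strong REs is at least [delta * M / 4] on [E] and equals [M / 2] overall.
    Finding none in [E], or at least [M] in all, is a deviation by at least the mean; the two
    Chebyshev bounds yield the terms [4 / delta] and [2]. *)
Lemma pr_light (n : 'I_N) (E : {set 'I_N}) (delta : R) : 0 < delta ->
  delta * N%:R <= (2 * #|E|)%:R ->
  pr P [set t | light M E (pattern (strong n) t)] <=
    (m.*2.+1)%:R * (4 / delta + 2) / M%:R.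
Proof.
move=> delta0 HE.
pose q : R := M%:R / (2 * N%:R).
have N_gt0 : 0 < N%:R :> R by rewrite ltr0n (leq_ltn_trans (leq0n n)).
have M_gt0 : 0 < M%:R :> R by rewrite ltr0n.
have q0 : 0 < q by rewrite divr_gt0// mulr_gt0.
have E0 : 0 < #|E|%:R :> R.
  by have : 0 < (2 * #|E|)%:R :> R; [exact: lt_le_trans (mulr_gt0 _ _) HE|rewrite !ltr0n; lia].
have Nq : #|[set: 'I_N]%SET|%:R * q = M%:R / 2.
  by rewrite cardsT card_ord /q; field; rewrite gt_eqF.
have mS := measurable_strong n.
have dev := @mdep_count_deviation R d T P N m (strong n) q mS (x_quantile n).
have indep (k l : 'I_N) : (k + m < l)%N -> pr P (strong n k `&` strong n l) = q * q.
  by move=> kl; rewrite strong_indep_far// !x_quantile.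
have mQ (Q : pred {set 'I_N}) : measurable [set t | Q (pattern (strong n) t)].
  exact: measurable_fin (measurable_pattern mS) _.
have H1 : pr P [set t | [disjoint pattern (strong n) t & E]%B] <=
    (m.*2.+1)%:R / (#|E|%:R * q).
  apply: (dev indep E (fun X => [disjoint X & E]%B)); first exact: mulr_gt0.
  by move=> X; rewrite -setI_eq0 => /eqP ->; rewrite cards0 sub0r sqrrN.
have H2 : pr P [set t | (M <= #|pattern (strong n) t|)%N] <=
    (m.*2.+1)%:R / (M%:R / 2).
  rewrite -Nq; apply: (dev indep [set: 'I_N]%SET (fun X => (M <= #|X|)%N)).
    by rewrite Nq divr_gt0.
  move=> X MX; rewrite Nq finset.setIT.
  have : M%:R <= #|X|%:R :> R by rewrite ler_nat.
  by move=> H; nra.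
have U : [set t | light M E (pattern (strong n) t)] =
    [set t | [disjoint pattern (strong n) t & E]%B] `|`
    [set t | (M <= #|pattern (strong n) t|)%N].
  by apply/seteqP; split => t /= /orP.
rewrite U; apply: le_trans (prU P _ _) _.
- exact: mQ (fun X => [disjoint X & E]%B).
- exact: mQ (fun X => (M <= #|X|)%N).
have Eq : delta * M%:R / 4 <= #|E|%:R * q.
  rewrite (_ : delta * M%:R / 4 = delta * N%:R / 2 * q); last first.
    by rewrite /q; field; rewrite gt_eqF.
  by rewrite ler_wpM2r ?(ltW q0)// ler_pdivrMr// [leRHS]mulrC -natrM.
apply: (le_trans (lerD H1 H2)).
rewrite -mulrDr -mulrA ler_wpM2l// mulrDl lerD//; last by rewrite invf_div.
apply: (@le_trans _ _ (delta * M%:R / 4)^-1).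
  by rewrite lef_pV2 ?posrE// ?divr_gt0// mulr_gt0.
rewrite le_eqVlt; apply/orP; left; apply/eqP; field.
by rewrite !gt_eqF.
Qed.

End Channel.

(** * Union bound over sets of users and sets of REs *)

Section UnionBound.
Variables (R : realType) (d : measure_display) (T : measurableType d).
Variable P : probability T R.
Variables (N m : nat) (h : 'I_N -> 'I_N -> 'I_N -> T -> (R * R)%type).
Hypothesis hch : mdep_fs_channel P m h.
Hypothesis h_atomless :
  forall (n k : 'I_N) (x : R), P [set t | cmod (h n n k t) = x] = 0%E.
Variables (Pw : 'I_N -> R) (N0 : R) (M : nat).
Hypothesis Pw0 : forall n, 0 < Pw n.
Hypothesis N00 : 0 < N0.
Hypothesis M0 : (0 < M)%N.
Hypothesis M_le : (M <= N)%N.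

Let g t := fun n1 n2 k => h n1 n2 k t.

Let mcmod n1 n2 k : measurable_fun setT (fun t => cmod (h n1 n2 k t)).
Proof. by case: hch => mh _; apply: measurableT_comp; [exact: measurable_cmod|exact: mh]. Qed.

(** Calibrating user [n] on the RE [n] suffices, since the gains of a pair are identically
    distributed over the REs. *)
Lemma exists_strong_threshold : exists x : 'I_N -> R,
  forall n k, pr P (strong h x n k) = M%:R / (2 * N%:R).
Proof.
have /choice[x xP] : forall n : 'I_N, exists x : R,
    pr P [set t | x <= cmod (h n n n t)] = M%:R / (2 * N%:R).
  have N2 : 0 < 2 * N%:R :> R by rewrite mulr_gt0// ltr0n (leq_trans M0).
  move=> n; apply: upper_quantile => //.
  - by move=> t; exact: cmod_ge0.
  - by rewrite divr_gt0// ltr0n.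
  - by rewrite ler_pdivrMr// mul1r -natrM ler_nat (leq_trans M_le)// leq_pmull.
by exists x => n k; rewrite (pr_strong hch x n k n); exact: xP.
Qed.

(** A null event, set aside because the equilibrium argument asks for nonzero gains. *)
Let zero_gain : set T :=
  \bigcup_(p : 'I_N * 'I_N * 'I_N) [set t | cmod (h p.1.1 p.1.2 p.2 t) = 0].

Let measurable_zero_gain1 n1 n2 k : measurable [set t | cmod (h n1 n2 k t) = 0].
Proof.
rewrite (_ : [set t | _] = setT `&` (fun t => cmod (h n1 n2 k t)) @^-1` [set 0]).
  exact: mcmod.
by rewrite setTI.
Qed.

Let pr_zero_gain : pr P zero_gain = 0.
Proof.
case: hch => _ [_ [h0 _]].
by apply: pr_bigcup0 => p //; rewrite /pr h0.
Qed.

(* [D] is any integer with [D * delta >= 1], so that a PNE with more than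
   [delta * N] sharing users has at least [N / D] of them. *)
Lemma pr_maxNc_gt (delta : R) (D : nat) : 0 < delta -> 1 <= D%:R * delta ->
  (m.*2.+1)%:R * (4 / delta + 2) / M%:R <= (8 ^+ D)^-1 ->
  pr P [set t | delta < (maxNc_PNE (g t) Pw N0 M)%:R / N%:R] <= (2^-1) ^+ N.
Proof.
move=> delta0 Ddelta small.
have [x xP] := exists_strong_threshold.
have N_gt0 : 0 < N%:R :> R by rewrite ltr0n (leq_trans M0).
have mh : forall n1 n2 k, measurable_fun setT (h n1 n2 k) by case: hch.
pose W n t := pattern (strong h x n) t.
have mW n X : measurable [set t | W n t = X].
  by apply: measurable_pattern => k; exact: measurable_strong hch _ _ _.
pose J (p : {set 'I_N} * {set 'I_N}) :=
  (N <= D * #|p.1|)%N && (delta * N%:R <= (2 * #|p.2|)%:R).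
pose B (p : {set 'I_N} * {set 'I_N}) :=
  [set t | forall n, n \in p.1 -> light M p.2 (W n t)].
have mB p : measurable (B p).
  rewrite (_ : B p = \bigcap_(n in [set` p.1]) [set t | light M p.2 (W n t)]) //.
  apply: fin_bigcap_measurable => // n _.
  exact: (measurable_fin (mW n)).
have prB p : J p -> pr P (B p) <= (8^-1) ^+ N.
  move=> /andP[ND HE].
  rewrite /B (pr_forall_indep p.1 (light M p.2) mW (strong_users_indep hch x)).
  (* Each factor is at most [8 ^ - D] and at least [N / D] users occur, so the product is at most
     [8 ^ - N]. *)
  apply: (@le_trans _ _ (\prod_(n in p.1) (8 ^+ D)^-1)).
    apply: ler_prod => n _; rewrite pr_ge0 (le_trans _ small)//.
    exact: (pr_light hch M0 xP n delta0 HE).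
  have e0 : 0 <= 8^-1 :> R by lra.
  have e1 : 8^-1 <= 1 :> R by lra.
  by rewrite prodr_const -exprVn -exprM; exact: ler_wiXn2l.
apply: (@le_trans _ _ (pr P (zero_gain `|` \big[setU/set0]_(p | J p) B p))).
  apply: le_pr.
  - exact: measurable_maxNc_gt.
  - apply: measurableU; first exact: fin_bigcup_measurable.
    exact: bigsetU_measurable.
  move=> t /= /(maxNc_PNE_gt _ _ _ _ _ delta0)[a aNE aN].
  case: (pselect (zero_gain t)) => [|nz]; [by left|right].
  have g0 n n' k : 0 < cmod (g t n n' k).
    rewrite lt_neqAle cmod_ge0 andbT eq_sym; apply/eqP => c0; apply: nz.
    by exists ((n, n'), k).
  pose p := (sharing_users a, empty_REs a).
  move: aN; rewrite ltr_pdivlMr// NcE => aN.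
  suff Jp : J p.
    rewrite -bigcup_seq_cond; exists p; first by rewrite /= mem_index_enum.
    move=> n nS; have := PNE_light_user Pw0 N00 M0 M_le x g0 aNE nS.
    by congr (light _ _ _); apply/setP => k; rewrite !inE; apply/idP/asboolP.
  apply/andP; split => /=.
    rewrite -(ler_nat R) natrM.
    apply: (@le_trans _ _ (D%:R * delta * N%:R)); first by rewrite ler_peMl// ltW.
    by rewrite -mulrA ler_wpM2l// ltW.
  by apply: (le_trans (ltW aN)); rewrite ler_nat sharing_le_double_empty.
apply: (le_trans (prU _ _ _)).
- exact: fin_bigcup_measurable.
- exact: bigsetU_measurable.
rewrite pr_zero_gain add0r; apply: (le_trans (pr_bigsetU _ _ _)) => //.
apply: (@le_trans _ _ (\sum_(p : {set 'I_N} * {set 'I_N}) (8^-1) ^+ N)).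
  rewrite [leLHS]big_mkcond/=; apply: ler_sum => p _.
  by case: ifP => [/prB//|_]; rewrite exprn_ge0// invr_ge0.
(* There are [2 ^ N * 2 ^ N] pairs, and the base 8 leaves [(4 / 8) ^ N]. *)
rewrite sumr_const card_prod -cardsT -powersetT card_powerset cardsT card_ord.
rewrite -[leLHS]mulr_natl natrM natrX -!exprMn.
by rewrite (_ : 2 * 2 / 8 = 2^-1 :> R)//; field.
Qed.

End UnionBound.

(** * Passage to the limit *)

Lemma near_ln_ge (R : realType) (K : R) : \forall N \near \oo, K <= ln (N%:R : R).
Proof.
exists (Num.truncn (expR K)).+1 => // N /= KN.
rewrite -[K]expRK ler_ln ?posrE ?expR_gt0//.
  by apply: ltW; apply: lt_le_trans (truncnS_gt _) _; rewrite ler_nat.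
by rewrite ltr0n; exact: leq_trans KN.
Qed.

Unset Implicit Arguments.

Theorem mainTheorem5 (R : realType) (m : nat)
  (d : nat -> measure_display) (T : forall N : nat, measurableType (d N))
  (P : forall N : nat, probability (T N) R)
  (h : forall N : nat, 'I_N -> 'I_N -> 'I_N -> T N -> (R * R)%type)
  (Pw : forall N : nat, 'I_N -> R) (N0 : R) (eps : R) (M : nat -> nat) :
  (forall N, mdep_fs_channel (P N) m (h N)) ->
  (forall N (n k : 'I_N) (x : R), P N [set t | cmod (h N n n k t) = x] = 0%E) ->
  (forall N (n : 'I_N), 0 < Pw N n) -> 0 < N0 ->
  0 < eps ->
  (forall N, (expR 1 + eps) * (m.+1)%:R * ln (N%:R) <= (M N)%:R) ->
  (fun N => (M N)%:R / N%:R) @ \oo --> (0 : R) ->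
  let Y N (t : T N) : R :=
    (maxNc_PNE (fun n1 n2 k => h N n1 n2 k t) (Pw N) N0 (M N))%:R / N%:R in
  (forall delta : R, 0 < delta ->
     (fun N => fine (P N [set t | delta < Y N t])) @ \oo --> (0 : R)) /\
  (forall A : forall N, T N -> profile N,
     (forall N (a : profile N), measurable [set t | A N t = a]) ->
     (forall N t, isPNE (fun n1 n2 k => h N n1 n2 k t) (Pw N) N0 (M N) (A N t)) ->
     forall delta : R, 0 < delta ->
       (fun N => fine (P N [set t | delta < (Nc (A N t))%:R / N%:R])) @ \oo --> (0 : R)).
Proof.
move=> hch atomless Pw0 N00 eps0 M_ln M_N Y.
(* [M N] tends to infinity because the coefficient of [ln N] is at least 1. *)
have big : forall K : R, \forall N \near \oo, K <= (M N)%:R.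
  move=> K; near=> N.
  have lnK : `|K| <= ln N%:R by near: N; exact: near_ln_ge.
  apply: (le_trans (ler_norm K)); apply: (le_trans lnK).
  apply: le_trans (M_ln N); apply: ler_peMl; first exact: le_trans lnK.
  rewrite -[leLHS]mulr1; apply: ler_pM; rewrite ?ler01 ?ler1n//.
  by rewrite ler_wpDr ?(ltW eps0)//; have := @expR_ge1Dx R 1; lra.
have rate : forall delta : R, 0 < delta -> \forall N \near \oo,
    [/\ (0 < M N)%N, (M N <= N)%N & pr (P N) [set t | delta < Y N t] <= 2^-1 ^+ N].
  move=> delta delta0.
  (* The least integer above [1 / delta], independent of [N]. *)
  pose D := (Num.truncn (delta^-1)).+1.
  have Dd : 1 <= D%:R * delta.
    by rewrite -ler_pdivrMr// div1r ltW// truncnS_gt.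
  near=> N.
  have M0 : (0 < M N)%N.
    by rewrite -(ltr_nat R) (@lt_le_trans _ _ 1)//; near: N; exact: big.
  have M_le : (M N <= N)%N.
    have N0' : (0 < N)%N by near: N; exists 1%N.
    have : (M N)%:R / N%:R < 1 :> R.
      near: N; have /cvgrPdist_lt/(_ 1 ltr01) := M_N.
      apply: filterS => N; rewrite /= sub0r normrN; exact: le_lt_trans (ler_norm _).
    by rewrite ltr_pdivrMr ?ltr0n// mul1r ltr_nat => /ltnW.
  split=> //; apply: (pr_maxNc_gt (hch N) (atomless N) (Pw0 N) N00 M0 M_le delta0 Dd).
  (* Cleared of denominators, the condition asks [M N] to exceed a constant depending only on [m],
     [delta] and [D]. *)
  rewrite ler_pdivrMr ?ltr0n// ler_pdivlMl ?exprn_gt0//.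
  by near: N; exact: big.
have lim (X : nat -> R) : (forall N, 0 <= X N) ->
    (\forall N \near \oo, X N <= 2^-1 ^+ N) -> X @ \oo --> (0 : R).
  move=> X0 Xle; apply: (@squeeze_cvgr _ _ _ _ (fun=> 0) (fun N => 2^-1 ^+ N)).
  - by apply: filterS Xle => N ->; rewrite X0.
  - exact: cvg_cst.
  - apply: cvg_expr; rewrite ger0_norm//; lra.
split => [delta delta0|A mA A_NE delta delta0]; apply: lim.
- by move=> N; exact: pr_ge0.
- by apply: filterS (rate _ delta0) => N [].
- by move=> N; exact: pr_ge0.
(* The selected equilibrium is among those over which the maximum runs, so its event lies in the one
   already bounded. *)
- apply: filterS (rate _ delta0) => N [M0 _]; apply: le_trans.
  apply: le_pr.
  + exact: (measurable_fin (mA N) (fun a => delta < (Nc a)%:R / N%:R)).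
  + by case: (hch N) => mh _; exact: measurable_maxNc_gt.
  + by move=> t /= AN; apply/maxNc_PNE_gt => //; exists (A N t).
Unshelve. all: by end_near.
Qed.
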